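(* Let $G$ be a Lie group with Lie algebra $\mathfrak g$, let $M$ be a proper $G$-manifold, and let $\mathcal U$ be an open and dense subset of the space $\mathfrak X(M)^G$ of $G$-equivariant vector fields on $M$, equipped with the Whitney $C^\infty$ topology. Then the collection $$C^\infty(M,\mathfrak g)^G\cdot\mathcal U=\{X+\partial(\psi)\mid X\in\mathcal U,\ \psi\in C^\infty(M,\mathfrak g)^G\}\subseteq\mathfrak X(M)^G$$ of all equivariant vector fields isomorphic to vector fields in $\mathcal U$ is also open and dense in $\mathfrak X(M)^G$.
   Context: A proper $G$-manifold is a smooth manifold with a smooth proper $G$-action. $\mathfrak X(M)^G$ is the space of smooth $G$-equivariant vector fields. $C^\infty(M,\mathfrak g)^G$ is the space of infinitesimal gauge transformations: smooth $\psi:M\to\mathfrak g$ with $\psi(g\cdot p)=\mathrm{Ad}(g)\psi(p)$; such $\psi$ induces $\partial(\psi)\in\mathfrak X(M)^G$, $\partial(\psi)(p)=\frac{d}{d\tau}|_0\exp(\tau\psi(p))\cdot p$. Equivariant vector fields $X,Y$ are isomorphic if $Y=X+\partial(\psi)$ for some $\psi\in C^\infty(M,\mathfrak g)^G$. The Whitney $C^\infty$ topology on $C^\infty(U,N)$ ($U,N$ manifolds) has as basis the sets $\{f\mid j^rf(U)\subseteq O\}$, for $r\in\mathbb Z_{\ge0}$ and $O$ open in the space $J^r(U,N)$ of $r$-jets. $\mathfrak X(M)^G$ carries the subspace topology from $C^\infty(M,TM)$. *)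

(* Defs.v *)
From HB Require Import structures.
From mathcomp Require Import all_boot all_order all_algebra.
From mathcomp Require Import all_classical all_reals all_analysis.
Set Implicit Arguments.
Unset Strict Implicit.
Unset Printing Implicit Defensive.
Import Order.TTheory GRing.Theory Num.Theory.
Import numFieldNormedType.Exports.
Local Open Scope classical_set_scope.
Local Open Scope quotient_scope.
Local Open Scope ring_scope.

Section Calculus.
Variables (R : realType) (m n : nat).
Implicit Types (f : 'rV[R]_m -> 'rV[R]_n).

(* pderivs [:: i1; ...; ik] f is the iterated partial derivative
   d_i1 (... (d_ik f)). *)
Definition pderivs (s : seq 'I_m) f : 'rV[R]_m -> 'rV[R]_n :=
  foldr (fun i g x => 'D_(delta_mx 0 i) g x) f s.

(* Intended for U open: all iterated partial derivatives of f exist on U and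
   are differentiable (in particular continuous) there. *)
Definition smooth_on (U : set 'rV[R]_m) f :=
  forall (s : seq 'I_m) x, U x -> differentiable (pderivs s f) x.

End Calculus.

(* chart_map is only meaningful on chart_dom. *)
Record chart (R : realType) (n : nat) (T : Type) := Chart {
  chart_dom : set T ;
  chart_map :> T -> 'rV[R]_n }.

(* Charted sets carry just the data of a family of charts; they are used to
   speak of smooth maps, tangent vectors and jets.  The axioms of manifolds are
   imposed in isManifold below. *)
HB.mixin Record isCharted (R : realType) (n : nat) (T : Type) := {
  atlas : set (chart R n T) }.

#[short(type="chartedType")]
HB.structure Definition Charted (R : realType) (n : nat) :=
  {T of isCharted R n T}.

Section Smooth.
Variables (R : realType) (m n : nat).
Variables (M : chartedType R m) (N : chartedType R n).

Definition charts_at (p : M) : set (chart R m M) :=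
  [set c | atlas c /\ chart_dom c p].

(* The map d \o f \o c^-1, set to 0 outside of the image of c. *)
Definition local_rep (f : M -> N) (c : chart R m M) (d : chart R n N)
    (x : 'rV[R]_m) : 'rV[R]_n :=
  xget 0 [set d (f p) | p in [set p | chart_dom c p /\ c p = x]].

(* On manifolds, openness of c (dom c `&` f^-1 (dom d)) for all c and d says
   that the sets f^-1 (dom d) are open, so that smooth maps are continuous. *)
Definition smooth (f : M -> N) :=
  forall (c : chart R m M) (d : chart R n N), atlas c -> atlas d ->
    open (c @` (chart_dom c `&` f @^-1` chart_dom d)) /\
    smooth_on (c @` (chart_dom c `&` f @^-1` chart_dom d)) (local_rep f c d).

End Smooth.
Arguments charts_at {R m M} p.

(* Second countable Hausdorff manifolds of dimension n, without boundary. *)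
HB.mixin Record isManifold (R : realType) (n : nat) T
    of Topological T & Charted R n T := {
  manifold_hausdorff : hausdorff_space T ;
  manifold_second_countable : @second_countable T ;
  atlas_cover : forall p : T, exists c : chart R n T, charts_at p c ;
  chart_dom_open :
    forall c : chart R n T, atlas c -> open (chart_dom c) ;
  chart_inj :
    forall c : chart R n T, atlas c -> {in chart_dom c &, injective c} ;
  chart_continuous :
    forall c : chart R n T, atlas c -> {in chart_dom c, continuous c} ;
  chart_open_map : forall c : chart R n T, atlas c ->
    forall A : set T, open A -> A `<=` chart_dom c -> open (c @` A) ;
  atlas_compatible : forall c d : chart R n T, atlas c -> atlas d ->
    smooth_on (c @` (chart_dom c `&` chart_dom d)) (local_rep id c d) }.

#[short(type="manifoldType")]
HB.structure Definition Manifold (R : realType) (n : nat) :=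
  {T of Topological T & Charted R n T & isManifold R n T}.

Section VectorSpaceCharts.
Variables (R : realType) (n : nat).

Definition rV_chart : chart R n 'rV[R]_n := Chart setT id.

HB.instance Definition _ := isCharted.Build R n 'rV[R]_n [set rV_chart].

End VectorSpaceCharts.

Section ProductCharts.
Variables (R : realType) (m n : nat).
Variables (M : chartedType R m) (N : chartedType R n).

Definition prod_chart (c : chart R m M) (d : chart R n N) :
    chart R (m + n) (M * N)%type :=
  Chart (chart_dom c `*` chart_dom d) (fun pq => row_mx (c pq.1) (d pq.2)).

HB.instance Definition _ := isCharted.Build R (m + n) (M * N)%type
  [set e | exists c d, [/\ atlas c, atlas d & e = prod_chart c d]].

End ProductCharts.

Section Tangent.
Variables (R : realType) (m : nat) (M : chartedType R m).

(* A tangent vector at p is the family of its coordinates in the charts at p,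
   which transforms according to the Jacobians of the transition maps.  The
   value is 0 on irrelevant charts, so that tangent vectors are determined by
   their coordinates. *)
Definition tangent_family (p : M) (v : chart R m M -> 'rV[R]_m) : Prop :=
  (forall c, ~ charts_at p c -> v c = 0) /\
  (forall c d, charts_at p c -> charts_at p d ->
    v d = 'd (local_rep (idfun : M -> M) c d) (c p) (v c)).

Definition tangent_pred (p : M) : {pred chart R m M -> 'rV[R]_m} :=
  [pred v | `[< tangent_family p v >]].

Fact tangent_submod_closed p : submod_closed (tangent_pred p).
Proof.
split=> [|a u v /asboolP[u0 uE] /asboolP[v0 vE]]; apply/asboolP; split=> //=.
- by move=> c d _ _; rewrite linear0.
- by move=> c cp; rewrite !fctE u0// v0// scaler0 addr0.
- move=> c d cp dp.
  have E w : (a *: u + w) = (fun e => a *: u e + w e) by [].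
  by rewrite E (uE c d)// (vE c d)// linearP.
Qed.

HB.instance Definition _ p :=
  GRing.isSubmodClosed.Build R (chart R m M -> 'rV[R]_m) (tangent_pred p)
    (tangent_submod_closed p).

Record tangent (p : M) := Tangent {
  tcoord :> chart R m M -> 'rV[R]_m ;
  tcoordP : tcoord \in tangent_pred p }.

HB.instance Definition _ p := [isSub for @tcoord p].
HB.instance Definition _ p := [Choice of tangent p by <:].
HB.instance Definition _ p :=
  [SubChoice_isSubLmodule of tangent p by <:].

(* The linear coordinates on the vector space T_p M. *)
Definition tangent_chart (p : M) (c : chart R m M) : chart R m (tangent p) :=
  Chart setT (fun v : tangent p => v c).

HB.instance Definition _ p := isCharted.Build R m (tangent p)
  [set tangent_chart p c | c in charts_at p].

Definition tangent_bundle := {p : M & tangent p}.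

Definition bundle_chart (c : chart R m M) : chart R (m + m) tangent_bundle :=
  Chart [set w : tangent_bundle | chart_dom c (projT1 w)]
        (fun w => row_mx (c (projT1 w)) (tcoord (projT2 w) c)).

HB.instance Definition _ := isCharted.Build R (m + m) tangent_bundle
  [set bundle_chart c | c in atlas].

(* v is the velocity at time t of the curve g through p = g t. *)
Definition is_velocity (g : R -> M) (t : R) (p : M) (v : tangent p) :=
  g t = p /\ forall c, charts_at p c -> is_derive t 1 (fun s => c (g s)) (v c).

(* Such a vector exists and is unique for smooth curves in manifolds. *)
Definition velocity (g : R -> M) (t : R) (p : M) : tangent p :=
  xget 0 [set v | is_velocity g t v].

End Tangent.
Arguments tangent {R m M} p.
Arguments tangent_bundle {R m} M.

(* The differential T_p f : T_p M -> T_q N, for f smooth and q = f p; q is a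
   separate argument because it is often only propositionally equal to f p. *)
Definition tangent_map (R : realType) (m n : nat)
    (M : chartedType R m) (N : chartedType R n) (f : M -> N) (p : M) (q : N)
    (v : tangent p) : tangent q :=
  xget 0 [set w : tangent q | forall c d, charts_at p c -> charts_at q d ->
            w d = 'd (local_rep f c d) (c p) (v c)].

Section Whitney.
Variables (R : realType) (m n : nat).
Variables (M : chartedType R m) (N : chartedType R n).

Record smooth_map := SmoothMap {
  smooth_fun :> M -> N ;
  smooth_funP : smooth smooth_fun }.

HB.instance Definition _ := gen_eqMixin smooth_map.
HB.instance Definition _ := gen_choiceMixin smooth_map.

(* (p, f) and (q, g) define the same r-jet. *)
Definition same_jet (r : nat) (x y : {classic M} * smooth_map) : Prop :=
  [/\ x.1 = y.1, x.2 x.1 = y.2 x.1 &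
     forall c d, charts_at (x.1 : M) c -> charts_at (x.2 x.1) d ->
     forall s : seq 'I_m, (size s <= r)%N ->
       pderivs s (local_rep x.2 c d) (c x.1) =
       pderivs s (local_rep y.2 c d) (c x.1)].

Fact same_jet_equiv r : equiv_class_of (fun x y => `[< same_jet r x y >]).
Proof.
split=> [x|x y|y x z].
- by apply/asboolP.
- apply/asbool_equiv_eq; split=> -[].
    move: x y => [p f] [q g] /= <- E H; split=> // c d cp dp s sr.
    by rewrite H// E.
  move: x y => [p f] [q g] /= <- E H; split=> // c d cp dp s sr.
  by rewrite H// E.
- move=> /asboolP xy /asboolP yz; apply/asboolP.
  move: x y z xy yz => [p f] [q g] [u h] [/= <- E H] [/= <- E' H'].
  split=> //=; first by rewrite E.
  by move=> c d cp dp s sr; rewrite H// H'// -E.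
Qed.

Canonical same_jet_rel r := EquivRelPack (same_jet_equiv r).

(* The space J^r(M, N). *)
Definition jet (r : nat) := {eq_quot same_jet_rel r}.

HB.instance Definition _ r := Choice.on (jet r).

Definition jet_at (r : nat) (f : smooth_map) (p : M) : jet r :=
  \pi_(jet r) (p : {classic M}, f).

(* Openness in J^r(M, N): around every jet in O, in all coordinates
   (c p, (d^s (d \o f \o c^-1) (c p))_{|s| <= r}) given by charts c and d at
   its source and target, O contains the jets with close enough coordinates. *)
Definition jet_open (r : nat) (O : set (jet r)) : Prop :=
  forall f p, O (jet_at r f p) ->
  forall c d, charts_at p c -> charts_at (f p) d ->
  exists2 e : R, 0 < e & forall (g : smooth_map) (q : M),
    chart_dom c q -> chart_dom d (g q) -> `|c q - c p| < e ->
    (forall s : seq 'I_m, (size s <= r)%N ->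
      `|pderivs s (local_rep g c d) (c q)
        - pderivs s (local_rep f c d) (c p)| < e) ->
    O (jet_at r g q).

Fact jet_openT r : jet_open (setT : set (jet r)).
Proof. by move=> f p _ c d _ _; exists 1. Qed.

Fact jet_openI r : setI_closed (@jet_open r).
Proof.
move=> A B Ao Bo f p [Af Bf] c d cp dp.
have [e1 e10 H1] := Ao _ _ Af c d cp dp.
have [e2 e20 H2] := Bo _ _ Bf c d cp dp.
exists (Num.min e1 e2); first by rewrite lt_min e10 e20.
move=> g q cq dq; rewrite lt_min => /andP[l1 l2] H; split.
- by apply: H1 => // s /H; rewrite lt_min => /andP[].
- by apply: H2 => // s /H; rewrite lt_min => /andP[].
Qed.

Fact jet_open_bigU r (I : Type) (F : I -> set (jet r)) :
  (forall i, jet_open (F i)) -> jet_open (\bigcup_i F i).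
Proof.
move=> Fo f p [i _ Fi] c d cp dp; have [e e0 H] := Fo _ _ _ Fi c d cp dp.
by exists e => // g q cq dq l H'; exists i => //; exact: H.
Qed.

HB.instance Definition _ r := isOpenTopological.Build (jet r)
  (@jet_openT r) (@jet_openI r) (@jet_open_bigU r).

Definition whitney_set (r : nat) (O : set (jet r)) : set smooth_map :=
  [set f | forall p, O (jet_at r f p)].

Definition whitney_base : set (set smooth_map) :=
  [set B | exists r (O : set (jet r)), open O /\ B = whitney_set O].

Fact whitney_base_cover : \bigcup_(B in whitney_base) B = setT.
Proof.
by apply/seteqP; split=> // f _; exists setT => //; exists 0, setT; split;
  [exact: openT | apply/seteqP].
Qed.

Lemma jet_at_inj r f g p q : jet_at r f p = jet_at r g q ->
  same_jet r (p : {classic M}, f) (q : {classic M}, g).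
Proof. by move/eqquotP/asboolP. Qed.

Lemma jet_at_le r r' f g p q : (r' <= r)%N ->
  jet_at r f p = jet_at r g q -> jet_at r' f p = jet_at r' g q.
Proof.
move=> le_r /jet_at_inj[pq E H]; apply/eqquotP/asboolP; split=> //.
by move=> c d cp dp s sr; apply: H => //; exact: leq_trans sr le_r.
Qed.

Lemma jet_open_lift r r' (O : set (jet r')) : (r' <= r)%N -> open O ->
  exists2 O' : set (jet r), open O' &
    forall f p, O' (jet_at r f p) <-> O (jet_at r' f p).
Proof.
move=> le_r Oo.
pose O' : set (jet r) :=
  [set j | exists f p, j = jet_at r f p /\ O (jet_at r' f p)].
have O'E f p : O' (jet_at r f p) <-> O (jet_at r' f p).
  split=> [[g [q [/(jet_at_le le_r) ->]]]//|Of]; by exists f, p.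
exists O' => //; rewrite /open/= => f p /O'E Of c d cp dp.
have [e e0 H] := Oo _ _ Of c d cp dp; exists e => // g q cq dq l H'.
by apply/O'E/H => // s sr; apply: H'; exact: leq_trans sr le_r.
Qed.

Fact whitney_base_join (A B : set smooth_map) (f : smooth_map) :
  whitney_base A -> whitney_base B -> A f -> B f ->
  exists C, [/\ whitney_base C, C f & C `<=` A `&` B].
Proof.
move=> [r [V [Vo ->]]] [r' [P [Po ->]]] Vf Pf.
have [V' V'o V'E] := jet_open_lift (leq_maxl r r') Vo.
have [P' P'o P'E] := jet_open_lift (leq_maxr r r') Po.
exists (whitney_set (V' `&` P')); split.
- by exists (maxn r r'), (V' `&` P'); split=> //; exact: openI.
- by move=> p; split; [apply/V'E|apply/P'E].
- by move=> g gVP; split=> p; have [/V'E ? /P'E ?] := gVP p.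
Qed.

HB.instance Definition _ :=
  @isBaseTopological.Build smooth_map (set smooth_map) whitney_base id
    whitney_base_cover whitney_base_join.

End Whitney.

HB.mixin Record isLieGroup (R : realType) (k : nat) G
    of Manifold R k G & Group G := {
  mulg_smooth : smooth (fun gh : G * G => (gh.1 * gh.2)%g) ;
  invg_smooth : smooth (fun g : G => (g^-1)%g) }.

#[short(type="lieGroupType")]
HB.structure Definition LieGroup (R : realType) (k : nat) :=
  {G of Manifold R k G & Group G & isLieGroup R k G}.

Section LieGroup.
Variables (R : realType) (k : nat) (G : lieGroupType R k).

Definition lie_algebra := tangent (1%g : G).
HB.instance Definition _ := GRing.Lmodule.on lie_algebra.
HB.instance Definition _ := Charted.on lie_algebra.

Definition Ad (g : G) : lie_algebra -> lie_algebra :=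
  @tangent_map R k k G G (fun h => g * h * g^-1)%g 1%g 1%g.

Definition one_parameter_subgroup (xi : lie_algebra) (gamma : R -> G) :=
  [/\ smooth (fun t : 'rV[R]_1 => gamma (t 0 0)),
      forall s t, gamma (s + t) = (gamma s * gamma t)%g &
      is_velocity gamma 0 xi].

(* exp xi = gamma 1 for the unique one-parameter subgroup gamma with
   gamma'(0) = xi. *)
Definition lie_exp (xi : lie_algebra) : G :=
  xget (fun=> 1%g) (one_parameter_subgroup xi) 1.

End LieGroup.

Record proper_action (R : realType) (k m : nat)
    (G : lieGroupType R k) (M : manifoldType R m) := ProperAction {
  act :> G -> M -> M ;
  act1 : forall p, act 1%g p = p ;
  actM : forall g h p, act (g * h)%g p = act g (act h p) ;
  act_smooth : smooth (fun gp : G * M => act gp.1 gp.2) ;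
  act_proper : forall K : set (M * M), compact K ->
    compact ((fun gp : G * M => (act gp.1 gp.2, gp.2)) @^-1` K) }.

Section Equivariant.
Variables (R : realType) (k m : nat) (G : lieGroupType R k).
Variables (M : manifoldType R m) (a : proper_action G M).

Definition section (X : forall p : M, tangent p) (p : M) : tangent_bundle M :=
  existT _ p (X p).

(* X(M)^G *)
Record equivariant_field := EquivariantField {
  field_fun :> forall p : M, tangent p ;
  field_smooth : smooth (section field_fun) ;
  field_equivariant : forall g p,
    field_fun (a g p) = tangent_map (a g) (a g p) (field_fun p) }.

HB.instance Definition _ := gen_eqMixin equivariant_field.
HB.instance Definition _ := gen_choiceMixin equivariant_field.

Definition field_map (X : equivariant_field) :
    smooth_map M (tangent_bundle M) :=
  SmoothMap (field_smooth X).

HB.instance Definition _ :=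
  Topological.copy equivariant_field (initial_topology field_map).

(* C^oo(M, g)^G *)
Record gauge := Gauge {
  gauge_fun :> M -> lie_algebra G ;
  gauge_smooth : smooth gauge_fun ;
  gauge_equivariant : forall g p, gauge_fun (a g p) = Ad g (gauge_fun p) }.

(* The vector field d(psi) induced by the gauge transformation psi. *)
Definition gauge_field (psi : gauge) (p : M) : tangent p :=
  velocity (fun t => a (lie_exp (t *: psi p)) p) 0 p.

Definition isomorphic_fields (X Y : equivariant_field) :=
  exists psi : gauge, forall p, Y p = X p + gauge_field psi p.

Definition gauge_saturation (U : set equivariant_field) :
    set equivariant_field :=
  [set Y | exists2 X, U X & isomorphic_fields X Y].

End Equivariant.

(* Main.v *)
(** If [Y = X + ∂ψ], then translation by [X - Y] maps [Y] to [X] and moves every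
    field only within its isomorphism class.  So it is enough that translations
    of equivariant fields are continuous for the Whitney topology; density is
    inherited from [U] through [ψ = 0].  The translation is postcomposition with
    the diffeomorphism [v |-> v - Y (π v) + X (π v)] of the tangent bundle, and
    postcomposition with a smooth map [w] acts continuously on r-jets, because
    the derivatives of [w \o g] of order at most [r] are sums of products of
    derivatives of [g] and of derivatives of [w] at values of [g].  In
    particular the smoothness of [∂ψ] is never at stake: [∂ψ = Y - X]. *)

Require Import Defs.
From HB Require Import structures.
From mathcomp Require Import all_boot all_order all_algebra.
From mathcomp Require Import all_classical all_reals all_analysis.

Set Implicit Arguments.
Unset Strict Implicit.
Unset Printing Implicit Defensive.
Import Order.TTheory GRing.Theory Num.Theory.
Import numFieldNormedType.Exports.
Local Open Scope classical_set_scope.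
Local Open Scope ring_scope.

(** * Differentiability: locality and reduction to coordinates *)

Lemma near_eq_differentiable (R : realType) (V W : normedModType R)
    (f g : V -> W) (x : V) :
  (\near x, f x = g x) -> differentiable f x -> differentiable g x.
Proof.
move=> fg df; have -> : g = f + (g - f) by rewrite addrC subrK.
apply: differentiableD => //.
have gf : \forall y \near (0 : V), g (y + x) = f (y + x).
  have := near_shift 0 x (fun z => g z = f z); rewrite subr0 => <-.
  by apply: filterS fg => z; exact: esym.
(* Since [g - f] vanishes near [x], its first-order expansion holds with zero linear part, which
   [diff_unique] identifies as the differential. *)
have E : (g - f) \o shift x = cst ((g - f) x) + (\0 : {linear V -> W}) +o_ 0 id.
  apply/eqaddoP => _/posnumP[e]; near=> y.
  rewrite !fctE /= !addr0.
  have -> : g x = f x by rewrite (nbhs_singleton fg).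
  have -> : g (y + x) = f (y + x).
    near: y; exact: gf.
  by rewrite !subrr normr0 mulr_ge0.
apply/diff_locallyP; rewrite (diff_unique _ E); last exact: cst_continuous.
by split => //; exact: cst_continuous.
Unshelve. all: by end_near. Qed.

Lemma differentiable_rV (R : realType) (V : normedModType R) n
    (f : V -> 'rV[R]_n) (x : V) :
  (forall j, differentiable (fun y => f y 0 j) x) -> differentiable f x.
Proof.
move=> df.
have -> : f = \sum_(j < n) (fun y => f y 0 j *: (delta_mx 0 j : 'rV[R]_n)).
  by apply/funext => y; rewrite fct_sumE [LHS]row_sum_delta.
by apply: differentiable_sum => j; exact: differentiableZl.
Qed.

Lemma differentiable_rV_coord (R : realType) (V : normedModType R) n
    (f : V -> 'rV[R]_n) (x : V) j :
  differentiable f x -> differentiable (fun y => f y 0 j) x.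
Proof.
move=> df; apply: (@differentiable_comp _ _ _ _ f (fun N => N 0 j)) => //.
exact: differentiable_coord.
Qed.

Lemma derive_rV_coord (R : realType) (V : normedModType R) n
    (f : V -> 'rV[R]_n) (x v : V) j :
  differentiable f x -> 'D_v f x 0 j = 'D_v (fun y => f y 0 j) x.
Proof. by move=> df; rewrite derive_mx ?mxE//; exact: diff_derivable. Qed.

(** * Derivatives of compositions and continuity of postcomposition on jets *)

Section Smooth.
Variable R : realType.

Lemma smooth_on_deriv m n (W : set 'rV[R]_m) (w : 'rV[R]_m -> 'rV[R]_n) i :
  smooth_on W w -> smooth_on W (fun x => 'D_(delta_mx 0 i) w x).
Proof.
move=> sw s x Wx; have := sw (rcons s i) x Wx.
by rewrite /pderivs foldr_rcons.
Qed.

Lemma smooth_on_differentiable m n (W : set 'rV[R]_m)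
    (w : 'rV[R]_m -> 'rV[R]_n) x :
  smooth_on W w -> W x -> differentiable w x.
Proof. by move=> sw; exact: (sw [::]). Qed.

Section JetOperators.
Variables (l m : nat) (W : set 'rV[R]_m).

(* Operators of order at most r in g; closed under the partial derivatives, up
   to raising r, by the chain and product rules. *)
Inductive jet_op (r : nat) : (('rV[R]_l -> 'rV[R]_m) -> 'rV[R]_l -> R) -> Prop :=
| jet_op0 : jet_op r (fun _ _ => 0)
| jet_op_comp n (w : 'rV[R]_m -> 'rV[R]_n) j :
    smooth_on W w -> jet_op r (fun g x => w (g x) 0 j)
| jet_op_pderivs s j :
    (size s <= r)%N -> jet_op r (fun g x => pderivs s g x 0 j)
| jet_op_add P Q : jet_op r P -> jet_op r Q ->
    jet_op r (fun g x => P g x + Q g x)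
| jet_op_mul P Q : jet_op r P -> jet_op r Q ->
    jet_op r (fun g x => P g x * Q g x).

Lemma jet_op_sum r k (P : 'I_k -> ('rV[R]_l -> 'rV[R]_m) -> 'rV[R]_l -> R) :
  (forall i, jet_op r (P i)) -> jet_op r (fun g x => \sum_(i < k) P i g x).
Proof.
elim: k P => [|k IH] P HP.
  have -> : (fun g x => \sum_(i < 0) P i g x) = (fun _ _ => 0).
    by apply/funext => g; apply/funext => x; rewrite big_ord0.
  exact: jet_op0.
have -> : (fun g x => \sum_(i < k.+1) P i g x) =
          (fun g x => P ord0 g x + \sum_(i < k) P (lift ord0 i) g x).
  by apply/funext => g; apply/funext => x; rewrite big_ord_recl.
by apply: jet_op_add => //; apply: IH.
Qed.

Lemma jet_op_widen r r' P : (r <= r')%N -> jet_op r P -> jet_op r' P.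
Proof.
move=> rr'; elim=> {P} [|n w j sw|s j sr|P Q _ ? _ ?|P Q _ ? _ ?].
- exact: jet_op0.
- exact: jet_op_comp.
- by apply: jet_op_pderivs; exact: leq_trans rr'.
- exact: jet_op_add.
- exact: jet_op_mul.
Qed.

Lemma jet_op_differentiable r P (A : set 'rV[R]_l) g x :
  jet_op r P -> smooth_on A g -> A `<=` g @^-1` W -> A x ->
  differentiable (P g) x.
Proof.
move=> JP sg AW Ax; elim: JP => {P} [|n w j sw|s j sr|P Q _ ? _ ?|P Q _ ? _ ?].
- exact: differentiable_cst.
- apply: differentiable_rV_coord; apply: (@differentiable_comp _ _ _ _ g w).
    exact: (smooth_on_differentiable sg Ax).
  by apply: (smooth_on_differentiable sw); exact: AW.
- by apply: differentiable_rV_coord; exact: sg.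
- exact: (@differentiableD _ _ _ (P g) (Q g)).
- exact: (@differentiableM _ _ (P g) (Q g)).
Qed.

(** [Q] is chosen before [A], [g] and [x]: one formula serves all maps, which later makes estimates
    uniform in [g] possible. *)
Lemma jet_op_derive r P i : jet_op r P ->
  exists2 Q, jet_op r.+1 Q & forall (A : set 'rV[R]_l) g x,
    smooth_on A g -> A `<=` g @^-1` W -> A x ->
    'D_(delta_mx 0 i) (P g) x = Q g x.
Proof.
elim=> {P} [|n w j sw|s j sr|P P' JP [Q JQ QE] JP' [Q' JQ' QE']|
            P P' JP [Q JQ QE] JP' [Q' JQ' QE']].
- exists (fun _ _ => 0); first exact: jet_op0.
  by move=> A g x _ _ _; rewrite derive_cst.
(* The chain rule, with the derivative of [g] expanded in the standard basis so that only partial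
   derivatives of [w] occur. *)
- exists (fun g x => \sum_(k < m)
      pderivs [:: i] g x 0 k * ('D_(delta_mx 0 k) w) (g x) 0 j).
    apply: jet_op_sum => k; apply: jet_op_mul; first exact: jet_op_pderivs.
    exact: jet_op_comp (smooth_on_deriv k sw).
  move=> A g x sg AW Ax.
  have dg : differentiable g x by exact: (smooth_on_differentiable sg Ax).
  have dw : differentiable w (g x).
    by apply: (smooth_on_differentiable sw); exact: AW.
  rewrite -(derive_rV_coord _ _ (f := w \o g)); last exact: differentiable_comp.
  rewrite deriveE; last exact: differentiable_comp.
  rewrite diff_comp//=.
  under eq_bigr do rewrite !deriveE//.
  rewrite {1}(row_sum_delta ('d g x _)) linear_sum/= summxE.
  by apply: eq_bigr => k _; rewrite linearZ mxE.
- exists (fun g x => pderivs (i :: s) g x 0 j); first exact: jet_op_pderivs.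
  by move=> A g x sg AW Ax; rewrite /= derive_rV_coord//; exact: sg.
- exists (fun g x => Q g x + Q' g x); first exact: jet_op_add.
  move=> A g x sg AW Ax.
  rewrite -(QE _ _ _ sg AW Ax) -(QE' _ _ _ sg AW Ax).
  by apply: (@deriveD _ _ _ (P g) (P' g));
    apply/diff_derivable/jet_op_differentiable; eassumption.
- exists (fun g x => P g x * Q' g x + P' g x * Q g x).
    by apply: jet_op_add; apply: jet_op_mul => //; exact: jet_op_widen (leqnSn r) _.
  move=> A g x sg AW Ax.
  rewrite -(QE _ _ _ sg AW Ax) -(QE' _ _ _ sg AW Ax).
  by apply: (@deriveM _ _ (P g) (P' g));
    apply/diff_derivable/jet_op_differentiable; eassumption.
Qed.

(** Convergence along this filter is convergence of the derivatives of [g] at [q] of order at most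
    [r] to those of [f] at [p]. The point [q] is left free, because a jet operator sees it only
    through these derivatives. *)
Definition jet_nbhs r (f : 'rV[R]_l -> 'rV[R]_m) (p : 'rV[R]_l) :
    set_system (('rV[R]_l -> 'rV[R]_m) * 'rV[R]_l)%type :=
  filter_from [set e : R | 0 < e] (fun e => [set gq |
    forall s : seq 'I_l, (size s <= r)%N ->
      `|pderivs s gq.1 gq.2 - pderivs s f p| < e]).

Global Instance jet_nbhs_filter r f p : Filter (jet_nbhs r f p).
Proof.
apply: filter_from_filter; first by exists 1 => /=.
move=> e1 e2 /= e10 e20; exists (Num.min e1 e2) => /=.
  by rewrite lt_min e10 e20.
by move=> gq H; split=> s /H; rewrite lt_min => /andP[].
Qed.

Lemma jet_nbhs_pderivs r f p s : (size s <= r)%N ->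
  pderivs s gq.1 gq.2 @[gq --> jet_nbhs r f p] --> pderivs s f p.
Proof.
move=> sr; apply/cvgrPdist_lt => e e0; exists e => // gq /(_ s sr).
by rewrite distrC.
Qed.

(** A jet operator is a polynomial in derivatives of [g] and in continuous functions of its value.
    The value is the derivative along the empty sequence, so it converges for every [r]. *)
Lemma jet_op_cvg r P f p : jet_op r P -> W (f p) ->
  P gq.1 gq.2 @[gq --> jet_nbhs r f p] --> P f p.
Proof.
move=> + Wfp; elim=> {P} [|n w j sw|s j sr|P Q _ ? _ ?|P Q _ ? _ ?].
- exact: cvg_cst.
- have cg : gq.1 gq.2 @[gq --> jet_nbhs r f p] --> f p.
    exact: (@jet_nbhs_pderivs r f p [::]).
  apply: (@cvg_comp _ _ _ _ (fun y => w y 0 j) _ _ _ cg).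
  apply: (@differentiable_continuous _ _ _ _ (fun y => w y 0 j)).
  by apply: differentiable_rV_coord; exact: (smooth_on_differentiable sw).
- apply: (@cvg_comp _ _ _ _ (fun N : 'rV_m => N 0 j) _ _ _
    (@jet_nbhs_pderivs r f p s sr)).
  exact: coord_continuous.
- exact: cvgD.
- exact: cvgM.
Qed.

(** Induction on [s], differentiating the previous formula once more. That formula holds only on
    [A], whose openness makes it hold near each point, as differentiation requires. *)
Lemma pderivs_comp n (w : 'rV[R]_m -> 'rV[R]_n) s j : smooth_on W w ->
  exists2 Q, jet_op (size s) Q & forall (A : set 'rV[R]_l) g x,
    open A -> smooth_on A g -> A `<=` g @^-1` W -> A x ->
    pderivs s (w \o g) x 0 j = Q g x.
Proof.
move=> sw; elim: s j => [|i s IH] j.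
  by exists (fun g x => w (g x) 0 j) => //; exact: jet_op_comp.
have [Q JQ QE] := IH j; have [Q' JQ' QE'] := jet_op_derive i JQ.
exists Q' => // A g x oA sg AW Ax.
rewrite -(QE' _ _ _ sg AW Ax) /= derive_rV_coord.
  apply: near_eq_derive; near=> y; apply: (QE A) => //.
  near: y; exact: open_nbhs_nbhs.
(* Exchanging a coordinate with the derivative asks for differentiability of [pderivs s (w \o g)]:
   each of its coordinates agrees near [x] with a jet operator. *)
apply: differentiable_rV => k; have [Qk JQk QkE] := IH k.
apply: near_eq_differentiable (jet_op_differentiable JQk sg AW Ax).
near=> y; apply/esym/(QkE A) => //.
near: y; exact: open_nbhs_nbhs.
Unshelve. all: by end_near. Qed.

Lemma smooth_on_comp n (w : 'rV[R]_m -> 'rV[R]_n) (A : set 'rV[R]_l) g :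
  open A -> smooth_on A g -> A `<=` g @^-1` W -> smooth_on W w ->
  smooth_on A (w \o g).
Proof.
move=> oA sg AW sw s x Ax; apply: differentiable_rV => j.
have [Q JQ QE] := pderivs_comp s j sw.
apply: near_eq_differentiable (jet_op_differentiable JQ sg AW Ax).
near=> y; apply/esym/(QE A) => //; near: y; exact: open_nbhs_nbhs.
Unshelve. all: by end_near. Qed.

Lemma jet_comp_continuous n (w : 'rV[R]_m -> 'rV[R]_n) r (A : set 'rV[R]_l) f p :
  smooth_on W w -> open A -> smooth_on A f -> A `<=` f @^-1` W -> A p ->
  forall e : R, 0 < e -> exists2 d : R, 0 < d & forall B g q,
    open B -> smooth_on B g -> B `<=` g @^-1` W -> B q ->
    (forall s, (size s <= r)%N -> `|pderivs s g q - pderivs s f p| < d) ->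
    forall s, (size s <= r)%N ->
      `|pderivs s (w \o g) q - pderivs s (w \o f) p| < e.
Proof.
move=> sw oA sf AW Ap e e0.
(* The bound [d] must serve all [s] at once. Sequences of length at most [r] are written as tuples,
   which range over finite types, so that only finitely many members of the filter are
   intersected. *)
suff [d d0 H] : \forall gq \near jet_nbhs r f p, forall B, open B ->
    smooth_on B gq.1 -> B `<=` gq.1 @^-1` W -> B gq.2 ->
    forall k : 'I_r.+1, forall s : k.-tuple 'I_l,
      `|pderivs s (w \o gq.1) gq.2 - pderivs s (w \o f) p| < e.
  exists d => // B g q oB sg BW Bq Hd s sr.
  have := H (g, q) Hd B oB sg BW Bq; rewrite -ltnS in sr.
  by move=> /(_ (Ordinal sr) (in_tuple s)).
suff H : forall k : 'I_r.+1, forall s : k.-tuple 'I_l,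
    \forall gq \near jet_nbhs r f p, forall B, open B ->
    smooth_on B gq.1 -> B `<=` gq.1 @^-1` W -> B gq.2 ->
      `|pderivs s (w \o gq.1) gq.2 - pderivs s (w \o f) p| < e.
  apply: filterS (filter_forall _ (fun k => filter_forall _ (H k))).
  by move=> gq {}H B oB sg BW Bq k s; exact: (H k s B).
move=> k s.
(* The norm of a row vector is the maximum over its finitely many coordinates. *)
suff H j : \forall gq \near jet_nbhs r f p, forall B, open B ->
    smooth_on B gq.1 -> B `<=` gq.1 @^-1` W -> B gq.2 ->
      `|pderivs s (w \o gq.1) gq.2 0 j - pderivs s (w \o f) p 0 j| < e.
  apply: filterS (filter_forall _ H) => gq {}H B oB sg BW Bq.
  rewrite [ltLHS]/Num.Def.normr/= mx_normrE.
  apply: bigmax_lt => // -[i j] _; rewrite !mxE ord1.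
  exact: (H j B).
have [Q JQ QE] := pderivs_comp s j sw.
have Jr : jet_op r Q by apply: jet_op_widen JQ; rewrite size_tuple -ltnS.
have /cvgrPdist_lt/(_ e e0) H := jet_op_cvg Jr (AW _ Ap).
apply: filterS H => gq H B oB sg BW Bq.
by rewrite (QE B)// (QE A)// distrC.
Qed.

End JetOperators.
End Smooth.

(** * Smooth maps on open subsets of Euclidean space *)

Section SmoothOn.
Variables (R : realType) (m n : nat).
Implicit Types (A : set 'rV[R]_m) (f g : 'rV[R]_m -> 'rV[R]_n).

Lemma pderivs_eq_on A f g s x : open A -> {in A, f =1 g} -> A x ->
  pderivs s f x = pderivs s g x.
Proof.
move=> oA fg; elim: s x => [|i s IH] x Ax /=; first by apply: fg; rewrite inE.
by apply: near_eq_derive; near=> y; apply: IH; near: y; exact: open_nbhs_nbhs.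
Unshelve. all: by end_near. Qed.

Lemma smooth_on_eq A f g : open A -> {in A, f =1 g} ->
  smooth_on A f -> smooth_on A g.
Proof.
move=> oA fg sf s x Ax; apply: near_eq_differentiable (sf s x Ax).
near=> y; apply: (pderivs_eq_on _ oA) => //; near: y; exact: open_nbhs_nbhs.
Unshelve. all: by end_near. Qed.

Lemma pderivs_lincomb A f g k s x :
  open A -> smooth_on A f -> smooth_on A g -> A x ->
  pderivs s (fun y => f y + k *: g y) x = pderivs s f x + k *: pderivs s g x.
Proof.
move=> oA sf sg; elim: s x => [//|i s IH] x Ax /=.
transitivity ('D_(delta_mx 0 i) (pderivs s f + k *: pderivs s g) x).
  by apply: near_eq_derive; near=> y; apply: IH; near: y; exact: open_nbhs_nbhs.
rewrite deriveD.
- by rewrite deriveZ//; apply: diff_derivable; exact: sg.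
- by apply: diff_derivable; exact: sf.
- by apply: diff_derivable; apply: differentiableZ; exact: sg.
Unshelve. all: by end_near. Qed.

(** The scalar lets one statement cover sums and differences: [translate_rep] uses both -1 and 1. *)
Lemma smooth_on_lincomb A f g k :
  open A -> smooth_on A f -> smooth_on A g ->
  smooth_on A (fun y => f y + k *: g y).
Proof.
move=> oA sf sg s x Ax.
apply: (@near_eq_differentiable _ _ _ (pderivs s f + k *: pderivs s g)).
  near=> y; apply/esym; apply: (@pderivs_lincomb A) => //.
  by near: y; exact: open_nbhs_nbhs.
by apply: differentiableD; [exact: sf|apply: differentiableZ; exact: sg].
Unshelve. all: by end_near. Qed.

Lemma linear_smooth_on A (f : {linear 'rV[R]_m -> 'rV[R]_n}) :
  continuous f -> smooth_on A f.
Proof.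
move=> cf s x _.
have [->|[c ->]] : pderivs s f = f \/ exists c, pderivs s f = cst c.
- elim: s => [|i s [IH|[c IH]]]; first by left.
  + right; exists (f (delta_mx 0 i)); apply/funext => y.
    by rewrite /= IH deriveE ?diff_lin//; exact: linear_differentiable.
  + by right; exists 0; apply/funext => y; rewrite /= IH derive_cst.
- exact: linear_differentiable.
- exact: differentiable_cst.
Qed.

Lemma cst_smooth_on A (v : 'rV[R]_n) : smooth_on A (cst v).
Proof.
move=> s x _; have [w ->] : exists w, pderivs s (cst v) = cst w.
  elim: s => [|i s [w IH]]; first by exists v.
  by exists 0; apply/funext => y; rewrite /= IH derive_cst.
exact: differentiable_cst.
Qed.

Lemma near_eq_diff (V W : normedModType R) (f g : V -> W) (x v : V) :
  (\near x, f x = g x) -> differentiable f x -> 'd f x v = 'd g x v.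
Proof.
move=> fg df; have dg := near_eq_differentiable fg df.
by rewrite -!deriveE//; exact: near_eq_derive.
Qed.

End SmoothOn.

(** * Local representatives, tangent vectors and tangent maps *)

Section LocalRep.
Variable R : realType.

Lemma local_repE m n (M : chartedType R m) (N : chartedType R n) (f : M -> N)
    c d p :
  {in chart_dom c &, injective c} -> chart_dom c p ->
  local_rep f c d (c p) = d (f p).
Proof.
move=> ci cp; rewrite /local_rep; case: xgetP => [y _ [q [cq cqp] <-]|H].
  by rewrite (ci q p) ?inE.
by exfalso; apply: (H (d (f p))); exists p.
Qed.

Section Composition.
Variables (m n l : nat) (M : manifoldType R m) (N : manifoldType R n).
Variables (L : chartedType R l).

Lemma local_rep_comp (f : M -> N) (g : N -> L) c d e :
  atlas c -> atlas d ->
  {in c @` (chart_dom c `&` f @^-1` chart_dom d),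
    local_rep g d e \o local_rep f c d =1 local_rep (g \o f) c e}.
Proof.
move=> ac ad x; rewrite inE => -[p [cp dp] <-] /=.
by rewrite !local_repE//; exact: chart_inj.
Qed.

(** The chain rule in charts. Representatives compose as expected on an open set around [c p], which
    is enough to compare differentials. The equation for [h] allows an [idfun] factor to be
    absorbed. *)
Lemma diff_local_rep_comp (f : M -> N) (g : N -> L) (h : M -> L) p q c d e v :
  h = g \o f -> f p = q -> charts_at p c -> charts_at q d ->
  open (c @` (chart_dom c `&` f @^-1` chart_dom d)) ->
  differentiable (local_rep f c d) (c p) ->
  differentiable (local_rep g d e) (d q) ->
  'd (local_rep h c e) (c p) v =
    'd (local_rep g d e) (d q) ('d (local_rep f c d) (c p) v).
Proof.
move=> -> + [ac cp] [ad dp] oA df dg => fpq.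
have E : local_rep f c d (c p) = d q.
  by rewrite local_repE ?fpq//; exact: chart_inj.
have dg' : differentiable (local_rep g d e) (local_rep f c d (c p)).
  by rewrite E.
have dgf := differentiable_comp df dg'.
have := congr1 (@^~ v) (diff_comp df dg'); rewrite /= E => <-.
apply/esym; apply: (near_eq_diff _ _ dgf); near=> x; apply: local_rep_comp => //.
rewrite inE; near: x; apply: open_nbhs_nbhs; split=> //.
by exists p; split=> //; rewrite /preimage/= fpq.
Unshelve. all: by end_near. Qed.

End Composition.

Section Tangent.
Variables (m : nat) (M : manifoldType R m).

Lemma tangent_ext (p : M) (v w : tangent p) :
  (forall c, charts_at p c -> v c = w c) -> v = w.
Proof.
move=> vw; apply/val_inj/funext => c /=.
have [cp|cp] := pselect (charts_at p c); first exact: vw.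
have /asboolP[v0 _] := tcoordP v; have /asboolP[w0 _] := tcoordP w.
by rewrite v0// w0.
Qed.

Lemma transition_open (c d : chart R m M) : atlas c -> atlas d ->
  open (c @` (chart_dom c `&` chart_dom d)).
Proof.
move=> ac ad; apply: (chart_open_map c ac) => [|p []//].
by apply: openI; exact: chart_dom_open.
Qed.

Lemma transition_differentiable p (c d : chart R m M) :
  charts_at p c -> charts_at p d ->
  differentiable (local_rep (idfun : M -> M) c d) (c p).
Proof.
move=> [ac cp] [ad dp].
by apply: (smooth_on_differentiable (atlas_compatible c d ac ad)); exists p.
Qed.

End Tangent.

Section TangentMap.
Variables (m n : nat) (M : manifoldType R m) (N : manifoldType R n).

(* As in smooth, the openness condition stands for the continuity of f. *)
Definition differentiable_at (f : M -> N) p :=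
  forall c d, charts_at p c -> charts_at (f p) d ->
    open (c @` (chart_dom c `&` f @^-1` chart_dom d)) /\
    differentiable (local_rep f c d) (c p).

Lemma tangent_map_coord (f : M -> N) p (v : tangent p) c d :
  differentiable_at f p -> charts_at p c -> charts_at (f p) d ->
  tangent_map f (f p) v d = 'd (local_rep f c d) (c p) (v c).
Proof.
move=> df cp dp; rewrite /tangent_map; case: xgetP => [w _ H|H]; first exact: H.
exfalso.
have /asboolP[_ vE] := tcoordP v.
(* [xget] returns a correct vector once one exists. The candidate is computed from the single source
   chart [c]; changing the target chart shows that it is a tangent vector, changing the source chart
   that its coordinates do not depend on [c]. *)
pose w e := if pselect (charts_at (f p) e) then
  'd (local_rep f c e) (c p) (v c) else 0.
have wE e : charts_at (f p) e -> w e = 'd (local_rep f c e) (c p) (v c).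
  by rewrite /w; case: pselect.
have wP : w \in tangent_pred (f p).
  apply/asboolP; split=> [e ne|e e' ep ep']; first by rewrite /w; case: pselect.
  have [oA de] := df c e cp ep.
  rewrite !wE//.
  exact: (diff_local_rep_comp (f := f) (g := idfun) _ erefl erefl cp ep oA de
    (transition_differentiable ep ep')).
apply: (H (Tangent wP)) => c' d' cp' dp' /=; rewrite wE//.
have [_ de] := df c' d' cp' dp'.
rewrite (vE _ _ cp cp').
exact: (diff_local_rep_comp (f := idfun) (g := f) _ erefl erefl cp cp'
  (transition_open cp.1 cp'.1) (transition_differentiable cp cp') de).
Qed.

(** Either no vector meets the condition and [xget] returns its default 0, or linearity of the
    differential makes all coordinates zero. *)
Lemma tangent_map0 (f : M -> N) p q : tangent_map f q (0 : tangent p) = 0.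
Proof.
rewrite /tangent_map; case: xgetP => // w _ H; apply: tangent_ext => d dq.
have [c cp] := atlas_cover p.
rewrite (H c d)//.
have -> : tcoord (0 : tangent p) = 0 by [].
have -> : tcoord (0 : tangent q) = 0 by [].
by rewrite linear0.
Qed.

End TangentMap.
End LocalRep.

(** * Translation of the tangent bundle along its fibers *)

Section FiberTranslation.
Variables (R : realType) (m : nat) (M : manifoldType R m).
Variables X Y : forall p : M, tangent p.
Hypotheses (smoothX : smooth (section X)) (smoothY : smooth (section Y)).

Definition translate (w : tangent_bundle M) : tangent_bundle M :=
  existT _ (projT1 w) (projT2 w - Y (projT1 w) + X (projT1 w)).

(* The representatives of X and Y have the same base component, which cancels
   out. *)
Definition translate_rep (d : chart R m M) (u : 'rV[R]_(m + m)) :=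
  u + -1 *: local_rep (section Y) d (bundle_chart d) (lsubmx u)
    + 1 *: local_rep (section X) d (bundle_chart d) (lsubmx u).

Lemma translate_repE d w : atlas d -> chart_dom (bundle_chart d) w ->
  translate_rep d (bundle_chart d w) = bundle_chart d (translate w).
Proof.
move=> ad; case: w => p v /= dp; rewrite /translate_rep row_mxKl.
rewrite !local_repE//; [|exact: chart_inj|exact: chart_inj].
rewrite /= -[(_ + _) d]/(v d - Y p d + X p d) scaleN1r scale1r.
by rewrite opp_row_mx !add_row_mx subrK.
Qed.

Lemma local_rep_section_smooth (Z : forall p : M, tangent p) d :
  smooth (section Z) -> atlas d ->
  smooth_on (d @` chart_dom d) (local_rep (section Z) d (bundle_chart d)).
Proof.
move=> sZ ad; have [_] := sZ d (bundle_chart d) ad (imageP _ ad).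
by rewrite (_ : _ `&` _ = chart_dom d)//; apply/seteqP; split=> [p []|].
Qed.

Lemma chart_image_open (d : chart R m M) : atlas d -> open (d @` chart_dom d).
Proof.
by move=> ad; apply: (chart_open_map d ad) => //; exact: chart_dom_open.
Qed.

Lemma lsubmx_preimage_open (A : set 'rV[R]_m) :
  open A -> open ((lsubmx : 'rV[R]_(m + m) -> _) @^-1` A).
Proof. by move=> oA; apply: open_comp => // u _; exact: continuous_lsubmx. Qed.

Lemma translate_rep_smooth d : atlas d ->
  smooth_on (lsubmx @^-1` (d @` chart_dom d)) (translate_rep d).
Proof.
move=> ad; have oA := lsubmx_preimage_open (chart_image_open ad).
have sl : smooth_on (lsubmx @^-1` (d @` chart_dom d))
    (lsubmx : 'rV[R]_(m + m) -> 'rV[R]_m).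
  by apply: linear_smooth_on; exact: continuous_lsubmx.
apply: smooth_on_lincomb => //; last first.
  exact: (smooth_on_comp oA sl _ (local_rep_section_smooth smoothX ad)).
apply: smooth_on_lincomb => //; last first.
  exact: (smooth_on_comp oA sl _ (local_rep_section_smooth smoothY ad)).
by apply: (@linear_smooth_on _ _ _ _ idfun) => u.
Qed.

Lemma bundle_local_rep_sub (f : M -> tangent_bundle M) c d : atlas c ->
  c @` (chart_dom c `&` f @^-1` chart_dom (bundle_chart d)) `<=`
  local_rep f c (bundle_chart d) @^-1` (lsubmx @^-1` (d @` chart_dom d)).
Proof.
move=> ac x [p [cp dp] <-] /=; rewrite local_repE//; last exact: chart_inj.
by rewrite /= row_mxKl; exists (projT1 (f p)).
Qed.

Lemma local_rep_translate (f : M -> tangent_bundle M) c d :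
  atlas c -> atlas d ->
  {in c @` (chart_dom c `&` f @^-1` chart_dom (bundle_chart d)),
    translate_rep d \o local_rep f c (bundle_chart d) =1
    local_rep (translate \o f) c (bundle_chart d)}.
Proof.
move=> ac ad x; rewrite inE => -[p [cp dp] <-] /=.
by rewrite !local_repE ?translate_repE//; exact: chart_inj.
Qed.

Lemma translate_smooth (f : M -> tangent_bundle M) :
  smooth f -> smooth (translate \o f).
Proof.
move=> sf c _ ac [d ad <-].
have [oA sA] := sf c (bundle_chart d) ac (imageP _ ad).
(* [translate] preserves base points, so preimages of bundle chart domains are unchanged and their
   openness carries over by conversion. *)
split=> //; apply: (smooth_on_eq oA (local_rep_translate ac ad)).
exact: (smooth_on_comp oA sA (bundle_local_rep_sub ac) (translate_rep_smooth ad)).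
Qed.

Definition translate_map (f : smooth_map M (tangent_bundle M)) :=
  SmoothMap (translate_smooth (smooth_funP f)).

(** This is [jet_comp_continuous] for [translate_rep d], read in charts. *)
Lemma translate_jet_continuous r (f : smooth_map M (tangent_bundle M)) p c d
    (e : R) :
  charts_at p c -> atlas d -> chart_dom (bundle_chart d) (f p) -> 0 < e ->
  exists2 e' : R, 0 < e' & forall (g : smooth_map M (tangent_bundle M)) q,
    chart_dom c q -> chart_dom (bundle_chart d) (g q) ->
    (forall s : seq 'I_m, (size s <= r)%N ->
      `|pderivs s (local_rep g c (bundle_chart d)) (c q)
        - pderivs s (local_rep f c (bundle_chart d)) (c p)| < e') ->
    forall s : seq 'I_m, (size s <= r)%N ->
      `|pderivs s (local_rep (translate_map g) c (bundle_chart d)) (c q)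
        - pderivs s (local_rep (translate_map f) c (bundle_chart d)) (c p)| < e.
Proof.
move=> [ac cp] ad dp e0.
have [oA sA] := smooth_funP f ac (imageP _ ad).
have Ap : (c @` (chart_dom c `&` f @^-1` chart_dom (bundle_chart d))) (c p).
  by exists p.
have [e' e'0 H] := jet_comp_continuous r (translate_rep_smooth ad) oA sA
  (bundle_local_rep_sub ac) Ap e0.
exists e' => // g q cq dq Hg s sr.
have [oB sB] := smooth_funP g ac (imageP _ ad).
have Bq : (c @` (chart_dom c `&` g @^-1` chart_dom (bundle_chart d))) (c q).
  by exists q.
have := H _ _ _ oB sB (bundle_local_rep_sub ac) Bq Hg s sr.
rewrite (pderivs_eq_on _ oB (local_rep_translate ac ad) Bq).
by rewrite (pderivs_eq_on _ oA (local_rep_translate ac ad) Ap).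
Qed.

Lemma whitney_translate r (O : set (jet M (tangent_bundle M) r)) :
  open O -> exists2 O' : set (jet M (tangent_bundle M) r), open O' &
    forall f, whitney_set O' f <-> whitney_set O (translate_map f).
Proof.
(* That the jet of translate_map f depends only on the jet of f is not needed
   to define O', and then follows from the openness of O. *)
move=> oO.
exists [set j | exists f p, j = jet_at r f p /\ O (jet_at r (translate_map f) p)].
  rewrite /open/= => f p [g [_ [/jet_at_inj[/= <- fg H] Og]]] c _ cp [[d ad <-] dp].
  have dfp : charts_at (f p) (bundle_chart d) by split=> //; exact: imageP.
  have dgp : charts_at (g p) (bundle_chart d) by rewrite -fg.
  have [e e0 He] := oO _ _ Og c (bundle_chart d) cp dgp.
  have [e' e'0 He'] := translate_jet_continuous r cp ad dgp.2 e0.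
  (* [e] bounds the distance of the source points and [e'] that of the derivatives. Since [f] and
     [g] have the same jet at [p], closeness to [f] is closeness to [g]. *)
  exists (Num.min e e'); first by rewrite lt_min e0 e'0.
  move=> h q cq dq; rewrite lt_min => /andP[cqp _] Hh.
  exists h, q; split=> //; apply: He => //; apply: He' => // s sr.
  by rewrite -(H _ _ cp dfp s sr); have := Hh s sr; rewrite lt_min => /andP[].
move=> f; split=> [fO' p|fO p]; last by exists f, p.
have [g [_ [/jet_at_inj[/= <- fg H] Og]]] := fO' p.
have [c cp] := atlas_cover p; have [d [ad dp]] := atlas_cover (projT1 (g p)).
have dgp : charts_at (g p) (bundle_chart d) by split=> //; exact: imageP.
have dfp : charts_at (f p) (bundle_chart d) by rewrite fg.
have [e e0 He] := oO _ _ Og c (bundle_chart d) cp dgp.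
have [e' e'0 He'] := translate_jet_continuous r cp ad dgp.2 e0.
apply: He; [exact: cp.2|exact: dfp.2|by rewrite subrr normr0|].
apply: He' => //; [exact: cp.2|exact: dfp.2|] => s sr.
by rewrite (H _ _ cp dfp s sr) subrr normr0.
Qed.

(** Open sets are unions of basic ones, and the preimage of a basic set is basic, given by jets of
    the same order. *)
Lemma translate_map_continuous : continuous translate_map.
Proof.
apply/continuousP => _ [D sD <-]; rewrite preimage_bigcup.
apply: bigcup_open => _ /sD[r [P [oP ->]]].
have [Q oQ QE] := whitney_translate oP.
exists [set whitney_set Q]; first by move=> _ ->; exists r, Q.
by rewrite bigcup_set1; apply/seteqP; split=> f /QE.
Qed.

End FiberTranslation.

(** * Equivariant fields and gauge transformations *)

Section Equivariance.
Variables (R : realType) (k m : nat) (G : lieGroupType R k).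
Variables (M : manifoldType R m) (a : proper_action G M).

Lemma prod_chart_inj (e : chart R k G) (c : chart R m M) :
  atlas e -> atlas c ->
  {in chart_dom (prod_chart e c) &, injective (prod_chart e c)}.
Proof.
move=> ae ac [g p] [h q]; rewrite !inE /= => -[/= eg cp] [/= eh cq].
move=> /eq_row_mx[egh cpq].
by congr pair; [apply: (chart_inj e ae)|apply: (chart_inj c ac)] => //;
  rewrite inE.
Qed.

Lemma action_differentiable_at g p : differentiable_at (a g) p.
Proof.
move=> c d [ac cp] [ad dp]; have [e [ae eg]] := atlas_cover g.
have aec : atlas (prod_chart e c) by exists e, c.
have [oA sA] := act_smooth a aec ad.
(* In charts, [h] is the inclusion of the slice over [g]; it expresses [a g] through the smooth
   action on the product. *)
pose h (x : 'rV[R]_m) : 'rV[R]_(k + m) := row_mx (e g) x.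
have dh x : differentiable h x.
  apply: differentiable_rV => j.
  have -> : (fun y => h y 0 j) = match fintype.split j with
      inl j1 => cst (e g 0 j1) | inr j2 => fun y => y 0 j2 end.
    by apply/funext => y; rewrite mxE; case: fintype.split.
  case: fintype.split => i; first exact: differentiable_cst.
  exact: differentiable_coord.
have hE q : h (c q) = prod_chart e c (g, q) by [].
set A := _ @` _ in oA sA.
(* The slice of the domain of the action is the domain for [a g], as injectivity of [e] identifies
   the group element. Openness then follows from continuity of [h]. *)
have AE : c @` (chart_dom c `&` a g @^-1` chart_dom d) = h @^-1` A.
  apply/seteqP; split=> [_ [q [cq dq] <-]|x].
    by exists (g, q).
  move=> [[g' q] [/= [eg' cq] dq] /eq_row_mx[E <-]].
  have <- : g' = g by apply: (chart_inj e ae) => //; rewrite inE.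
  by exists q.
have oB : open (c @` (chart_dom c `&` a g @^-1` chart_dom d)).
  by rewrite AE; apply: open_comp => // x _; exact: differentiable_continuous.
have Bp : (c @` (chart_dom c `&` a g @^-1` chart_dom d)) (c p) by exists p.
split=> //.
apply: (@near_eq_differentiable _ _ _
  (local_rep (fun gp : G * M => a gp.1 gp.2) (prod_chart e c) d \o h)).
  near=> x.
  have [q [cq dq] <-] : (c @` (chart_dom c `&` a g @^-1` chart_dom d)) x.
    by near: x; exact: open_nbhs_nbhs.
  rewrite /comp hE !local_repE//; last exact: chart_inj.
  exact: prod_chart_inj.
apply: differentiable_comp => //; apply: (smooth_on_differentiable sA).
by rewrite AE in Bp.
Unshelve. all: by end_near. Qed.

Lemma equivariant_field_ext (X Y : equivariant_field a) :
  (forall p, X p = Y p) -> X = Y.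
Proof.
case: X Y => [X sX eX] [Y sY eY] /= XY.
have E : X = Y by apply: functional_extensionality_dep.
by subst Y; congr EquivariantField; exact: Prop_irrelevance.
Qed.

Definition translate_field (X Y Z : equivariant_field a) p : tangent p :=
  Z p - Y p + X p.

(** The tangent map of [a g] is linear in charts, so equivariance passes to [Z - Y + X]. *)
Lemma translate_field_equivariant X Y Z g p :
  translate_field X Y Z (a g p) =
  tangent_map (a g) (a g p) (translate_field X Y Z p).
Proof.
apply: tangent_ext => d dq; have [c cp] := atlas_cover p.
have TE v := tangent_map_coord v (@action_differentiable_at g p) cp dq.
have E q e : (translate_field X Y Z q) e = Z q e - Y q e + X q e by [].
by rewrite TE !E !field_equivariant !TE linearD linearB.
Qed.

(** The section of [Z - Y + X] is convertible to [translate] after the section of [Z], so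
    [translate_smooth] applies. *)
Definition equivariant_translate (X Y Z : equivariant_field a) :=
  EquivariantField
    (translate_smooth (field_smooth X) (field_smooth Y) (field_smooth Z) :
      smooth (section (translate_field X Y Z)))
    (translate_field_equivariant X Y Z).

Lemma equivariant_translate_continuous X Y :
  continuous (equivariant_translate X Y).
Proof.
apply/continuousP => _ [V oV <-].
have /continuousP/(_ V oV) oW :=
  @translate_map_continuous _ _ _ _ _ (field_smooth X) (field_smooth Y).
(* The topology on fields is initial for [field_map], which intertwines the two translations by
   conversion. *)
eexists; first exact: oW.
by [].
Qed.

Lemma gauge0_smooth : smooth (fun _ : M => 0 : lie_algebra G).
Proof.
move=> c _ ac [e e1 <-].
have -> : chart_dom c `&` (fun=> 0 : lie_algebra G) @^-1`
    chart_dom (tangent_chart (1%g : G) e) = chart_dom c.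
  by apply/seteqP; split=> [p []|].
have oA := chart_image_open ac.
split=> //; apply: (smooth_on_eq oA _ (@cst_smooth_on _ _ _ _ 0)) => x.
by rewrite inE => -[p cp <-]; rewrite local_repE//; exact: chart_inj.
Qed.

Lemma gauge0_equivariant g (p : M) : (0 : lie_algebra G) = Ad g 0.
Proof. by rewrite /Ad tangent_map0. Qed.

Definition gauge0 : gauge a := Gauge gauge0_smooth gauge0_equivariant.

(** The curve is constant because [s *: 0 = 0], whatever the value of [lie_exp 0]; hence any
    velocity is 0, and so is the default of [xget]. *)
Lemma gauge_field0 p : gauge_field gauge0 p = 0.
Proof.
rewrite /gauge_field /velocity; case: xgetP => // v _ [_ H].
apply: tangent_ext => c cp; have /@derive_val <- := H c cp.
rewrite (_ : (fun s : R => _) = cst (c (a (lie_exp (0 : lie_algebra G)) p))).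
  by rewrite derive_cst.
by apply/funext => s; rewrite /= scaler0.
Qed.

Lemma sub_gauge_saturation (U : set (equivariant_field a)) :
  U `<=` gauge_saturation U.
Proof.
by move=> X UX; exists X => //; exists gauge0 => p; rewrite gauge_field0 addr0.
Qed.

Lemma open_gauge_saturation (U : set (equivariant_field a)) :
  open U -> open (gauge_saturation U).
Proof.
move=> oU; rewrite openE => Y [X UX [psi XY]].
have /continuousP/(_ U oU) oV := @equivariant_translate_continuous X Y.
have VY : (equivariant_translate X Y @^-1` U) Y.
  rewrite /preimage/= (_ : equivariant_translate X Y Y = X)//.
  by apply: equivariant_field_ext => p; rewrite /= /translate_field subrr add0r.
apply: filterS (open_nbhs_nbhs (conj oV VY)) => Z UZ.
(* The same [psi] works for every [Z]: [Y = X + ∂ψ] gives [Z = (Z - Y + X) + ∂ψ]. *)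
exists (equivariant_translate X Y Z) => //; exists psi => p /=.
by rewrite /translate_field -addrA -XY subrK.
Qed.

End Equivariance.

Theorem theorem5p25 (R : realType) (k m : nat) (G : lieGroupType R k)
    (M : manifoldType R m) (a : proper_action G M)
    (U : set (equivariant_field a)) :
  open U -> dense U ->
  open (gauge_saturation U) /\ dense (gauge_saturation U).
Proof.
move=> oU dU; split; first exact: open_gauge_saturation.
move=> V V0 oV; have [X [VX UX]] := dU V V0 oV.
by exists X; split=> //; exact: sub_gauge_saturation.
Qed.
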